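(* Suppose the face functionals $\mathcal L_0,\dots,\mathcal L_d$ are linearly independent on $\mathbb S_2(S_d)$. Then there exists a decomposition $\mathbb S_2(S_d)=\mathbb V\oplus\mathbb W$ such that: (1) $\mathbb W$ has dimension $d+1$ and $\mathbb W\perp\mathbb V$ with respect to $\langle\cdot,\cdot\rangle_\Omega$; (2) the matrix $M=[\mathcal L_j(\psi_i)]_{j,i=0}^d$, formed with a basis $\psi_0,\dots,\psi_d$ of $\mathbb W$, is invertible; (3) by an appropriate change of basis in $\mathbb W$, one can normalize $M$ to the identity, $M=I_{d+1}$. If, in addition, the basis $\rho_1,\dots,\rho_{\tilde d}$ of $\mathbb V$ is chosen orthonormal with respect to $\langle\cdot,\cdot\rangle_\Omega$, then (with the basis of $\mathbb W$ from (3)) $G=I_{\tilde d}$, $C=0$, and the Schur complement $T=M-\tilde CG^{-1}C$ takes the form $T=M=I_{d+1}$.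
   Context: Let $d\ge 2$ and let $S_d\subset\mathbb R^d$ be a nondegenerate $d$-simplex with vertices $\boldsymbol v_0,\dots,\boldsymbol v_d$ and barycentric coordinates $\lambda_0,\dots,\lambda_d$. $F_j$ is the face opposite $\boldsymbol v_j$. $\mathbb P_k(X)$ is the space of (restrictions to $X$ of) polynomials of total degree at most $k$. $\Omega\in L^1(S_d)$ is a probability density, strictly positive a.e. in the interior of $S_d$. For each $j$, the induced face density $\omega_j$ is the normalized conditional trace of $\Omega$ on $F_j$: for every $\phi$ continuous on $F_j$ (extended continuously to $S_d$), $$\int_{F_j}\phi\,\omega_j\,d\boldsymbol x=\lim_{\varepsilon\to0^+}\frac{\int_{\{\lambda_j<\varepsilon\}}\phi\,\Omega\,d\boldsymbol\sigma}{\int_{\{\lambda_j<\varepsilon\}}\Omega\,d\boldsymbol\sigma};$$ it is assumed that this limit exists and defines a probability density $\omega_j\in L^1(F_j)$, positive a.e. on $F_j$ (with respect to $(d-1)$-dimensional Lebesgue measure). Set $\langle f,g\rangle_\Omega=\int_{S_d}fg\,\Omega\,d\boldsymbol\sigma$ and $\langle f,g\rangle_{\omega_j}=\int_{F_j}fg\,\omega_j\,d\boldsymbol x$ (functions on $S_d$ are restricted to $F_j$). $\mathbb S_2(S_d)=\{p\in\mathbb P_2(S_d):\langle p,\varphi\rangle_\Omega=0\ \forall\varphi\in\mathbb P_1(S_d)\}$, of dimension $d(d+1)/2$. Let $\tilde d=(d-2)(d+1)/2=\dim\mathbb S_2(S_d)-(d+1)$. For each $j=0,\dots,d$ let $q_j\in\mathbb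 P_2(F_j)$ satisfy $\langle q_j,\varphi\rangle_{\omega_j}=0$ for all $\varphi\in\mathbb P_1(F_j)$, and set $\mathcal L_j(f)=\langle f,q_j\rangle_{\omega_j}$. Given a decomposition $\mathbb S_2(S_d)=\mathbb V\oplus\mathbb W$ with bases $\rho_1,\dots,\rho_{\tilde d}$ of $\mathbb V$ and $\psi_0,\dots,\psi_d$ of $\mathbb W$: $[G]_{k\ell}=\langle\rho_\ell,\rho_k\rangle_\Omega$, $[C]_{ki}=\langle\psi_i,\rho_k\rangle_\Omega$, $[\tilde C]_{j\ell}=\mathcal L_j(\rho_\ell)$, $[M]_{ji}=\mathcal L_j(\psi_i)$, with $i,j=0,\dots,d$ and $k,\ell=1,\dots,\tilde d$ (if $d=2$, $\tilde d=0$, the blocks $G,C,\tilde C$ are empty and $T=M$). *)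

(* Defs.v *)
From HB Require Import structures.
From mathcomp Require Import all_boot all_order all_algebra.
From mathcomp.multinomials Require Import -(notations) mpoly.
From mathcomp Require Import all_classical all_reals all_analysis.
From mathcomp Require Import measurable_realfun.

Set Implicit Arguments.
Unset Strict Implicit.
Unset Printing Implicit Defensive.

Import Order.TTheory GRing.Theory Num.Theory.
Import numFieldNormedType.Exports.

Local Open Scope classical_set_scope.
Local Open Scope ring_scope.

Section Subspaces.
Context (R : fieldType) (E : lmodType R).

Definition is_subspace (V : set E) : Prop :=
  V 0 /\ forall (a : R) (u v : E), V u -> V v -> V (a *: u + v).

Definition is_basis (n : nat) (V : set E) (e : 'I_n -> E) : Prop :=
  (V = [set x | exists a : 'I_n -> R, x = \sum_(i < n) a i *: e i]) /\
  (forall a : 'I_n -> R, \sum_(i < n) a i *: e i = 0 -> forall i, a i = 0).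

Definition has_dim (n : nat) (V : set E) : Prop :=
  exists e : 'I_n -> E, is_basis V e.

Definition direct_sum (U V W : set E) : Prop :=
  [/\ is_subspace V, is_subspace W,
      U = [set x | exists v w, [/\ V v, W w & x = v + w]] &
      V `&` W = [set 0]].

Definition change_basis (n : nat) (P : 'M[R]_n) (e : 'I_n -> E) : 'I_n -> E :=
  fun i => \sum_(l < n) P l i *: e l.

End Subspaces.

Definition rV_display : measure_display -> measure_display.
Proof. exact. Qed.

Section MeasurableRV.
Context (R : realType) (n : nat).

Let coord (i : 'I_n) (x : 'rV[R]_n) : R := x ord0 i.

Let rV_set0 : g_sigma_preimage coord set0.
Proof. exact: sigma_algebra0. Qed.

Let rV_setC A : g_sigma_preimage coord A -> g_sigma_preimage coord (~` A).
Proof. exact: sigma_algebraC. Qed.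

Let rV_bigcup (F : (set 'rV[R]_n)^nat) :
  (forall i, g_sigma_preimage coord (F i)) ->
  g_sigma_preimage coord (\bigcup_i F i).
Proof. exact: sigma_algebra_bigcup. Qed.

(* The sigma-algebra generated by the coordinates, i.e. the Borel one. *)
HB.instance Definition _ := @isMeasurable.Build
  (rV_display default_measure_display) 'rV[R]_n
  (g_sigma_preimage coord) rV_set0 rV_setC rV_bigcup.

End MeasurableRV.

Section MeasurableRVTheory.
Context (R : realType).

Lemma measurable_coord n (i : 'I_n) :
  measurable_fun [set: 'rV[R]_n] (fun x : 'rV[R]_n => x ord0 i).
Proof.
move=> _ Y mY; rewrite setTI; apply: sub_sigma_algebra => /=.
rewrite -bigcup_seq/=; exists i => /=; first by rewrite mem_index_enum.
by exists Y => //; rewrite setTI.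
Qed.

Lemma measurable_fun_rV d (T : measurableType d) n (f : T -> 'rV[R]_n) :
  (forall i, measurable_fun [set: T] (fun t => f t ord0 i)) ->
  measurable_fun [set: T] f.
Proof.
move=> mf _ A mA; rewrite setTI.
move: A mA; apply: smallest_sub.
  split => [|B mB|F mF]; first by rewrite preimage_set0; exact: measurable0.
    by rewrite setTD preimage_setC; exact: measurableC.
  by rewrite preimage_bigcup; exact: bigcupT_measurable.
move=> B; rewrite -bigcup_seq/= => -[i _ [Y mY <-]].
rewrite setTI -comp_preimage -[X in measurable X]setTI.
exact: mf.
Qed.

Definition row_cons n (z : R * 'rV[R]_n) : 'rV[R]_n.+1 :=
  row_mx (z.1%:M : 'rV[R]_1) z.2.

Fixpoint lebesgue_rV (n : nat) : set 'rV[R]_n -> \bar R :=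
  match n with
  | 0 => \d_(0 : 'rV[R]_0)
  | m.+1 => pushforward (@lebesgue_measure R \x lebesgue_rV (n := m))%E
              (@row_cons m)
  end.


Let row_cons0 n (z : R * 'rV[R]_n) : row_cons z ord0 ord0 = z.1.
Proof.
have := row_mxEl (z.1%:M : 'rV[R]_1) z.2 ord0 ord0.
rewrite [X in _ = X -> _]mxE mulr1n => <-; congr (row_cons z _ _); exact/val_inj.
Qed.

Let row_consS n (z : R * 'rV[R]_n) (i : 'I_n) :
  row_cons z ord0 (lift ord0 i) = z.2 ord0 i.
Proof.
rewrite -(row_mxEr (z.1%:M : 'rV[R]_1) z.2 ord0 i).
by congr (row_cons z _ _); exact/val_inj.
Qed.

Lemma measurable_row_cons n :
  measurable_fun [set: R * 'rV[R]_n] (@row_cons n).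
Proof.
apply: measurable_fun_rV => i.
case: (unliftP ord0 i) => [k|] ->.
  under eq_fun do rewrite row_consS.
  apply: (measurableT_comp (measurable_coord k)).
  exact: measurable_snd.
under eq_fun do rewrite row_cons0.
exact: measurable_fst.
Qed.

Let row_uncons n (x : 'rV[R]_n.+1) : R * 'rV[R]_n :=
  (x ord0 ord0, \row_i x ord0 (lift ord0 i)).

Let measurable_row_uncons n :
  measurable_fun [set: 'rV[R]_n.+1] (@row_uncons n).
Proof.
apply/measurable_fun_pair; first exact: measurable_coord.
apply: measurable_fun_rV => i.
by under eq_fun do rewrite mxE; exact: measurable_coord.
Qed.

Let row_consK n : cancel (@row_cons n) (@row_uncons n).
Proof.
move=> z; rewrite /row_uncons row_cons0 [RHS]surjective_pairing; congr pair.
by apply/rowP => i; rewrite mxE row_consS.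
Qed.

Section ConsMeasure.
Context (n : nat) (mu : {sigma_finite_measure set 'rV[R]_n -> \bar R}).

Let nu := pushforward (@lebesgue_measure R \x mu)%E (@row_cons n).

Let nu_measure : {measure set 'rV[R]_n.+1 -> \bar R} :=
  measure_function_pushforward__canonical__measure_function_Measure
    (@lebesgue_measure R \x mu)%E (@measurable_row_cons n).

Let nu_sigma_finite : sigma_finite setT nu.
Proof.
have /sigma_finiteP[F [TF ndF Foo]] :=
  sigma_finiteT (@lebesgue_measure R : {sigma_finite_measure set _ -> \bar R}).
have /sigma_finiteP[G [TG ndG Goo]] := sigma_finiteT mu.
exists (fun k => @row_uncons n @^-1` (F k `*` G k)).
  rewrite -preimage_bigcup; apply/esym/seteqP; split => // x _ /=.
  have [i _ Fi] : (\bigcup_k F k) (row_uncons x).1 by rewrite -TF.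
  have [j _ Gj] : (\bigcup_k G k) (row_uncons x).2 by rewrite -TG.
  exists (maxn i j) => //; split.
  - by move: Fi; exact/subsetPset/ndF/leq_maxl.
  - by move: Gj; exact/subsetPset/ndG/leq_maxr.
move=> k; have [mF Fk] := Foo k; have [mG Gk] := Goo k; split.
  rewrite -[X in measurable X]setTI; apply: measurable_row_uncons => //.
  exact: measurableX.
rewrite /nu /pushforward -comp_preimage.
rewrite (_ : _ \o _ = id); last by apply/funext => z /=; rewrite row_consK.
by rewrite product_measure1E// lte_mul_pinfty// ge0_fin_numE.
Qed.

HB.instance Definition _ := isMeasure.Build _ _ _ nu
  (measure0 nu_measure) (measure_ge0 nu_measure)
  (@measure_semi_sigma_additive _ _ _ nu_measure).

HB.instance Definition _ := Measure_isSigmaFinite.Build _ _ _ nu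
  nu_sigma_finite.

Definition lebesgue_rV_step : {sigma_finite_measure set 'rV[R]_n.+1 -> \bar R} := nu.

End ConsMeasure.

Lemma lebesgue_rV_is_measure n :
  exists mu : {sigma_finite_measure set 'rV[R]_n -> \bar R},
    lebesgue_rV (n := n) = mu :> (set 'rV[R]_n -> \bar R).
Proof.
elim: n => [|n [mu IH]]; first by exists (\d_(0 : 'rV[R]_0)).
by exists (lebesgue_rV_step mu); rewrite /= IH.
Qed.

Let lebesgue_rV0 n : lebesgue_rV (n := n) set0 = 0%E.
Proof. by have [mu ->] := lebesgue_rV_is_measure n; exact: measure0. Qed.

Let lebesgue_rV_ge0 n A : (0 <= lebesgue_rV (n := n) A)%E.
Proof. by have [mu ->] := lebesgue_rV_is_measure n; exact: measure_ge0. Qed.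

Let lebesgue_rV_sigma_additive n : semi_sigma_additive (lebesgue_rV (n := n)).
Proof.
have [mu ->] := lebesgue_rV_is_measure n.
exact: measure_semi_sigma_additive.
Qed.

HB.instance Definition _ n := isMeasure.Build _ _ _ (lebesgue_rV (n := n))
  (lebesgue_rV0 n) (@lebesgue_rV_ge0 n) (@lebesgue_rV_sigma_additive n).

Let lebesgue_rV_sigma_finite n : sigma_finite setT (lebesgue_rV (n := n)).
Proof.
by have [mu ->] := lebesgue_rV_is_measure n; exact: sigma_finiteT.
Qed.

HB.instance Definition _ n := Measure_isSigmaFinite.Build _ _ _
  (lebesgue_rV (n := n)) (lebesgue_rV_sigma_finite n).

Lemma lebesgue_rV_box n (A : 'I_n -> set R) : (forall i, measurable (A i)) ->
  lebesgue_rV [set x : 'rV[R]_n | forall i, A i (x ord0 i)] =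
  (\prod_(i < n) lebesgue_measure (A i))%E.
Proof.
elim: n A => [|n IH] A mA.
  rewrite big_ord0 /= diracE mem_set//.
  by case=> i i0; have := i0; rewrite ltn0.
have [mu muE] := lebesgue_rV_is_measure n.
rewrite big_ord_recl -IH// /= /pushforward muE -product_measure1E//; last first.
  rewrite (_ : [set x | _] = \bigcap_(i in [set: 'I_n])
    (fun x : 'rV[R]_n => x ord0 i) @^-1` A (lift ord0 i)); last first.
    by apply/seteqP; split => x /= h i => [_|]; exact: h.
  apply: fin_bigcap_measurable => // i _.
  by rewrite -[X in measurable X]setTI; exact: measurable_coord.
  exact: mA.
congr (_ _); apply/seteqP; split => z /=.
  move=> h; split => [|i]; first by have := h ord0; rewrite row_cons0.
  by have := h (lift ord0 i); rewrite row_consS.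
by case=> h0 hS i; case: (unliftP ord0 i) => [k|] ->; rewrite ?row_consS ?row_cons0.
Qed.

End MeasurableRVTheory.
Arguments lebesgue_rV {R} n A.

Section Simplex.
Context (R : realType).

Definition simplex (m n : nat) (w : 'I_m.+1 -> 'rV[R]_n) : set 'rV[R]_n :=
  [set x | exists a : 'I_m.+1 -> R,
    [/\ forall i, 0 <= a i, \sum_i a i = 1 & x = \sum_i a i *: w i]].

Definition edges (m n : nat) (w : 'I_m.+1 -> 'rV[R]_n) : 'M[R]_(m, n) :=
  \matrix_(k < m) (w (lift ord0 k) - w ord0).

Definition affine_param (m n : nat) (w : 'I_m.+1 -> 'rV[R]_n)
    (t : 'rV[R]_m) : 'rV[R]_n :=
  w ord0 + t *m edges w.

Lemma measurable_affine_param m n (w : 'I_m.+1 -> 'rV[R]_n) :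
  measurable_fun [set: 'rV[R]_m] (affine_param w).
Proof.
apply: measurable_fun_rV => i.
under eq_fun do rewrite !mxE.
apply: measurable_funD; first exact: measurable_cst.
apply: measurable_sum => k; apply: measurable_funM; first exact: measurable_coord.
exact: measurable_cst.
Qed.

(* The m-dimensional Lebesgue (surface) measure of the affine hull of the m+1
   points w_i: the image of Lebesgue measure on R^m by the affine
   parametrization, times the Gram factor sqrt(det(E E^T)). *)
Definition affine_measure (m n : nat) (w : 'I_m.+1 -> 'rV[R]_n) :
    set 'rV[R]_n -> \bar R :=
  fun A => ((Num.sqrt (\det (edges w *m (edges w)^T)))%:E
            * pushforward (lebesgue_rV m) (affine_param w) A)%E.

Section AffineMeasure.
Context (m n : nat) (w : 'I_m.+1 -> 'rV[R]_n).

Let image_measure : {measure set 'rV[R]_n -> \bar R} :=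
  measure_function_pushforward__canonical__measure_function_Measure
    (lebesgue_rV m) (measurable_affine_param w).

Let scaled_measure : {measure set 'rV[R]_n -> \bar R} :=
  mscale (NngNum (sqrtr_ge0 (\det (edges w *m (edges w)^T)))) image_measure.

HB.instance Definition _ := isMeasure.Build _ _ _ (affine_measure w)
  (measure0 scaled_measure) (measure_ge0 scaled_measure)
  (@measure_semi_sigma_additive _ _ _ scaled_measure).

End AffineMeasure.

Context (d : nat) (v : 'I_d.+1 -> 'rV[R]_d).

Definition vertex_mx : 'M[R]_d.+1 :=
  \matrix_(i < d.+1) row_mx (1%:M : 'rV[R]_1) (v i).

Definition affinely_independent : Prop :=
  forall a : 'I_d.+1 -> R,
    \sum_i a i = 0 -> \sum_i a i *: v i = 0 -> forall i, a i = 0.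

Let vertex_mx0 (b : 'rV[R]_d.+1) :
  (b *m vertex_mx) ord0 (lshift d (ord0 : 'I_1)) = \sum_i b ord0 i.
Proof.
rewrite mxE; apply: eq_bigr => j _; rewrite [vertex_mx _ _]mxE.
by rewrite (row_mxEl (1%:M : 'rV[R]_1)) [_%:M _ _]mxE mulr1.
Qed.

Let vertex_mxS (b : 'rV[R]_d.+1) (k : 'I_d) :
  (b *m vertex_mx) ord0 (rshift 1 k) = (\sum_i b ord0 i *: v i) ord0 k.
Proof.
rewrite mxE summxE; apply: eq_bigr => j _.
by rewrite [vertex_mx _ _]mxE [RHS]mxE (row_mxEr (1%:M : 'rV[R]_1)).
Qed.

Lemma vertex_mx_unit : affinely_independent -> vertex_mx \in unitmx.
Proof.
move=> ai; rewrite -row_free_unit; apply: inj_row_free => b b0.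
apply/rowP => i; rewrite [RHS]mxE; apply: ai.
  by rewrite -vertex_mx0 b0 mxE.
by apply/rowP => k; rewrite -vertex_mxS b0 !mxE.
Qed.

(* The solution of a *m vertex_mx = (1, x), see [baryP]. *)
Definition bary (x : 'rV[R]_d) (j : 'I_d.+1) : R :=
  (row_mx (1%:M : 'rV[R]_1) x *m invmx vertex_mx) ord0 j.

Lemma baryP (x : 'rV[R]_d) : affinely_independent ->
  \sum_j bary x j = 1 /\ \sum_j bary x j *: v j = x.
Proof.
move=> /vertex_mx_unit nd.
pose b := row_mx (1%:M : 'rV[R]_1) x *m invmx vertex_mx.
have bE : b *m vertex_mx = row_mx (1%:M : 'rV[R]_1) x by exact: mulmxKV.
split.
  by rewrite -[LHS]vertex_mx0 -/b bE (row_mxEl (1%:M : 'rV[R]_1)) mxE.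
by apply/rowP => k; rewrite -vertex_mxS bE (row_mxEr (1%:M : 'rV[R]_1)).
Qed.

(* The vertices other than [v j]; their number is d = d.-1.+1 when d > 0. *)
Definition face_vertices (j : 'I_d.+1) : 'I_d.-1.+1 -> 'rV[R]_d :=
  fun k => v (inord (bump j k)).

Definition face (j : 'I_d.+1) : set 'rV[R]_d := simplex (face_vertices j).

Definition face_measure (j : 'I_d.+1) : {measure set 'rV[R]_d -> \bar R} :=
  affine_measure (face_vertices j).

End Simplex.

Section Polynomials.
Context (R : realType) (d : nat).

(* The restriction of a polynomial to X is represented by the function equal to
   it on X and to 0 (= [point]) outside X, so that polynomials agreeing on X are
   identified. [mmeasure mdeg p] is [msize p], the total degree plus one. *)
Definition poly_space (k : nat) (X : set 'rV[R]_d) : set ('rV[R]_d -> R) :=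
  [set f | exists2 p : mpoly d R, (mmeasure mdeg p <= k.+1)%N &
     f = (fun x : 'rV[R]_d => meval (x ord0) p) \_ X].

Definition inner (mu : {measure set 'rV[R]_d -> \bar R}) (X : set 'rV[R]_d)
    (w f g : 'rV[R]_d -> R) : R :=
  \int[mu]_(x in X) (f x * g x * w x).

Definition probability_density (mu : {measure set 'rV[R]_d -> \bar R})
    (X : set 'rV[R]_d) (w : 'rV[R]_d -> R) : Prop :=
  [/\ mu.-integrable X (EFin \o w),
      {ae mu, forall x, X x -> 0 <= w x} &
      \int[mu]_(x in X) w x = 1].

Context (v : 'I_d.+1 -> 'rV[R]_d).

(* [phi] runs over the continuous functions on the simplex, i.e. over all the
   continuous extensions of continuous functions on the face. *)
Definition conditional_trace (Omega : 'rV[R]_d -> R) (j : 'I_d.+1)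
    (omega : 'rV[R]_d -> R) : Prop :=
  forall phi : 'rV[R]_d -> R, {within simplex v, continuous phi} ->
    (fun eps : R =>
       (\int[lebesgue_rV d]_(x in simplex v `&` [set x | bary v x j < eps])
          (phi x * Omega x)) /
       (\int[lebesgue_rV d]_(x in simplex v `&` [set x | bary v x j < eps])
          Omega x))
    @ 0^'+ --> \int[face_measure v j]_(x in face v j) (phi x * omega x).

Definition inner_Omega (Omega f g : 'rV[R]_d -> R) : R :=
  inner (lebesgue_rV d) (simplex v) Omega f g.

(* The integral only sees the values of [f] and [g] on the face. *)
Definition inner_face (omega : 'I_d.+1 -> 'rV[R]_d -> R) (j : 'I_d.+1)
    (f g : 'rV[R]_d -> R) : R :=
  inner (face_measure v j) (face v j) (omega j) f g.

Definition S2 (Omega : 'rV[R]_d -> R) : set ('rV[R]_d -> R) :=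
  [set p | poly_space 2 (simplex v) p /\
    forall phi, poly_space 1 (simplex v) phi -> inner_Omega Omega p phi = 0].

Definition face_functional (omega q : 'I_d.+1 -> 'rV[R]_d -> R)
    (j : 'I_d.+1) (f : 'rV[R]_d -> R) : R :=
  inner_face omega j f (q j).

End Polynomials.

(* The product is always even, so the halving is exact. *)
Definition dtilde (d : nat) : nat := ((d - 2) * (d + 1))./2.

Section Matrices.
Context (R : realType) (d n : nat) (v : 'I_d.+1 -> 'rV[R]_d).
Context (Omega : 'rV[R]_d -> R) (omega q : 'I_d.+1 -> 'rV[R]_d -> R).
Implicit Types (rho : 'I_n -> 'rV[R]_d -> R) (psi : 'I_d.+1 -> 'rV[R]_d -> R).

Definition G_mx rho : 'M[R]_n :=
  \matrix_(k, l) inner_Omega v Omega (rho l) (rho k).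

Definition C_mx rho psi : 'M[R]_(n, d.+1) :=
  \matrix_(k, i) inner_Omega v Omega (psi i) (rho k).

Definition Ct_mx rho : 'M[R]_(d.+1, n) :=
  \matrix_(j, l) face_functional v omega q j (rho l).

Definition M_mx psi : 'M[R]_d.+1 :=
  \matrix_(j, i) face_functional v omega q j (psi i).

Definition T_mx rho psi : 'M[R]_d.+1 :=
  M_mx psi - Ct_mx rho *m invmx (G_mx rho) *m C_mx rho psi.

End Matrices.

(* Main.v *)
Require Import Defs.
From HB Require Import structures.
From mathcomp Require Import all_boot all_order all_algebra.
From mathcomp.multinomials Require Import -(notations) mpoly.
From mathcomp Require Import all_classical all_reals all_analysis.
From mathcomp Require Import measurable_realfun.

(* A polynomial vanishing a.e. on the interior of the simplex is zero, so
   <.,.>_Omega is an inner product on P_2, and S_2, the orthogonal complement of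
   P_1 in P_2, has dimension dim P_2 - dim P_1. Take for V the joint kernel of
   the d + 1 independent functionals L_j on S_2, and for W the orthogonal
   complement of V in S_2. A vector in the kernel of M gives an element of W
   annihilated by every L_j, that is, an element of V `&` W = 0; hence M is
   invertible, and changing the basis of W by the inverse of M yields M = 1. *)

Set Implicit Arguments.
Unset Strict Implicit.
Unset Printing Implicit Defensive.

Import Order.TTheory GRing.Theory Num.Theory.
Import numFieldNormedType.Exports.

Local Open Scope classical_set_scope.
Local Open Scope ring_scope.

(** * Linear algebra of subspaces: joint kernels, orthogonal complements, changes of basis *)

Section FiniteDimension.
Context (R : fieldType) (E : lmodType R).
Implicit Types (U V W : set E).

(** Linearity is relative to [U] because integrals are additive only on integrable functions. *)
Definition linear_on U (f : E -> R) : Prop :=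
  forall a u v, U u -> U v -> f (a *: u + v) = a * f u + f v.

Lemma subspace_sum U (I : finType) (a : I -> R) (e : I -> E) :
  is_subspace U -> (forall i, U (e i)) -> U (\sum_i a i *: e i).
Proof.
move=> [U0 UL] Ue; elim/big_ind: _ => // [x y Ux Uy|i _].
  by rewrite -[x]scale1r; exact: UL.
by rewrite -[_ *: _]addr0; exact: UL.
Qed.

Lemma linear_on0 U f : is_subspace U -> linear_on U f -> f 0 = 0.
Proof.
move=> [U0 _] fL; have := fL 1 0 0 U0 U0.
by rewrite scaler0 addr0 mul1r -{1}[f 0]addr0 => /addrI.
Qed.

Lemma linear_on_sum U f (I : finType) (a : I -> R) (e : I -> E) :
  is_subspace U -> linear_on U f -> (forall i, U (e i)) ->
  f (\sum_i a i *: e i) = \sum_i a i * f (e i).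
Proof.
move=> sU fL Ue; have [U0 UL] := sU.
pose K x y := U x /\ f x = y; suff: K (\sum_i a i *: e i) (\sum_i a i * f (e i)).
  by case.
elim/big_ind2 : _ => [|r x s y [Ux <-] [Uy <-]|i _].
- by split => //; exact: linear_on0 fL.
- rewrite /K -{1 2}[x]scale1r fL// mul1r; split=> //; exact: UL.
- rewrite /K -[_ *: _]addr0; split; first exact: UL.
  by rewrite fL// (linear_on0 sU fL) addr0.
Qed.

Lemma basis_subspace n U (e : 'I_n -> E) : is_basis U e -> is_subspace U.
Proof.
move=> [-> _]; split => /=.
  by exists (fun=> 0); rewrite big1// => i _; rewrite scale0r.
move=> a _ _ [b ->] [c ->]; exists (fun i => a * b i + c i).
rewrite scaler_sumr -big_split/=; apply: eq_bigr => i _.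
by rewrite scalerA scalerDl.
Qed.

Lemma basis_in n U (e : 'I_n -> E) i : is_basis U e -> U (e i).
Proof.
move=> [-> _]; exists (fun j => (j == i)%:R) => /=.
rewrite (bigD1 i)//= eqxx scale1r big1 ?addr0// => j /negbTE ->.
by rewrite scale0r.
Qed.

Lemma has_dim_subspace n U : has_dim n U -> is_subspace U.
Proof. by case=> e /basis_subspace. Qed.

Lemma has_dim_kernel n k U (L : 'I_k -> E -> R) :
  has_dim n U -> (forall j, linear_on U (L j)) ->
  (forall c : 'I_k -> R, (forall u, U u -> \sum_j c j * L j u = 0) ->
     forall j, c j = 0) ->
  has_dim (n - k) [set u | U u /\ forall j, L j u = 0].
Proof.
move=> [e eB] LL Lfree; have sU := basis_subspace eB.
have Ue i := basis_in i eB.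
pose comb (c : 'rV[R]_n) := \sum_i c ord0 i *: e i.
pose A := \matrix_(i < n, j < k) L j (e i).
have LE c j : L j (comb c) = (c *m A) ord0 j.
  by rewrite mxE (linear_on_sum _ sU)//; apply: eq_bigr => i _; rewrite mxE.
(* Independence of the functionals says that no nontrivial combination of the columns of [A]
   vanishes, i.e. that [A^T] is row free. *)
have rA : \rank A = k.
  rewrite -mxrank_tr; apply/eqP; rewrite -/(row_free _); apply: inj_row_free.
  move=> b b0; apply/rowP => j; rewrite [RHS]mxE.
  apply: (Lfree (fun j => b ord0 j)) => u; rewrite {1}eB.1 => -[a ->].
  under eq_bigr do rewrite (linear_on_sum _ sU)// mulr_sumr.
  rewrite exchange_big big1// => i _ /=.
  have /rowP/(_ i) := b0; rewrite !mxE => bi.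
  transitivity (a i * \sum_(j0 < k) b ord0 j0 * A^T j0 i); last by rewrite bi mulr0.
  by rewrite mulr_sumr; apply: eq_bigr => l _; rewrite !mxE mulrCA.
have <- : \rank (kermx A) = (n - k)%N by rewrite mxrank_ker rA.
pose B := row_base (kermx A).
have combM (m : nat) (D : 'rV[R]_m) (X : 'M[R]_(m, n)) :
    comb (D *m X) = \sum_r D ord0 r *: comb (row r X).
  rewrite /comb; under eq_bigr do rewrite mxE scaler_suml.
  rewrite exchange_big; apply: eq_bigr => r _ /=.
  by rewrite scaler_sumr; apply: eq_bigr => i _; rewrite mxE scalerA.
have comb_inj c : comb c = 0 -> c = 0.
  by move=> c0; apply/rowP => i; rewrite [RHS]mxE; apply: eB.2 c0 i.
exists (fun r => comb (row r B)); split.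
  apply/seteqP; split => [u /= [Uu Lu]|u /= [a ->]].
    move: Uu; rewrite eB.1 => -[a ua].
    have uE : u = comb (\row_i a i).
      by rewrite ua; apply: eq_bigr => i _; rewrite mxE.
    have : (\row_i a i <= B)%MS.
      rewrite eq_row_base; apply/sub_kermxP/rowP => j.
      by rewrite -LE -uE Lu mxE.
    case/submxP => D DE; exists (fun r => D ord0 r).
    by rewrite uE DE combM.
  have <- : comb ((\row_r a r) *m B) = \sum_r a r *: comb (row r B).
    by rewrite combM; apply: eq_bigr => r _; rewrite mxE.
  split; first by apply: subspace_sum.
  move=> j; rewrite LE -mulmxA.
  have -> : B *m A = 0 by apply/sub_kermxP; rewrite eq_row_base.
  by rewrite mulmx0 mxE.
move=> a a0 r.
have : (\row_r a r) *m B = 0.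
  by apply: comb_inj; rewrite combM -[RHS]a0; apply: eq_bigr => i _; rewrite mxE.
have /row_free_inj rB : row_free B by exact: row_base_free.
by rewrite -(mul0mx _ B) => /rB /rowP /(_ r); rewrite !mxE.
Qed.

Section InnerProduct.
Context (U : set E) (ip : E -> E -> R).
Hypothesis sU : is_subspace U.
Hypothesis ipL : forall w, U w -> linear_on U (ip^~ w).
Hypothesis ipC : forall u v, ip u v = ip v u.
Hypothesis ip_eq0 : forall u, U u -> ip u u = 0 -> u = 0.

Lemma ip_suml (I : finType) (a : I -> R) (e : I -> E) w :
  U w -> (forall i, U (e i)) ->
  ip (\sum_i a i *: e i) w = \sum_i a i * ip (e i) w.
Proof. by move=> Uw; exact: linear_on_sum sU (ipL Uw). Qed.

Definition orth_in V : set E := [set u | U u /\ forall v, V v -> ip u v = 0].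

(** Orthogonality to [V] is the vanishing of the k functionals [ip u (rho j)]. If a combination of
    them is zero on [U], the same combination of the [rho j] is orthogonal to itself, hence zero. *)
Lemma has_dim_orth n k V : has_dim n U -> has_dim k V -> V `<=` U ->
  has_dim (n - k) (orth_in V).
Proof.
move=> dU [rho rB] VU; have Urho i : U (rho i) by apply: VU; exact: basis_in rB.
have -> : orth_in V = [set u | U u /\ forall j, ip u (rho j) = 0].
  apply/seteqP; split => u /= [Uu uV]; split => //.
    by move=> j; apply: uV; exact: basis_in rB.
  move=> v.
  rewrite {1}rB.1 => -[a ->]; rewrite ipC ip_suml//.
  by rewrite big1// => i _; rewrite ipC uV ?mulr0//; exact: basis_in rB.
apply: has_dim_kernel => // [j|c c0]; first exact: ipL.
apply: rB.2; have Us := subspace_sum c sU Urho.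
apply: ip_eq0 => //; rewrite ip_suml//.
by rewrite -[RHS](c0 _ Us); apply: eq_bigr => i _; rewrite ipC.
Qed.

Lemma orth_subspace V : V `<=` U -> is_subspace (orth_in V).
Proof.
case: sU => U0 UL VU; split=> [|a u v [Uu uV] [Uv vV]].
  by split => // v Vv; exact: linear_on0 sU (ipL (VU _ Vv)).
split=> [|w Vw]; first exact: UL.
by rewrite (ipL (VU _ Vw))// uV// vV// mulr0 addr0.
Qed.

(** The [V] component is the orthogonal projection, computed with the Gram matrix of a basis. The
    intersection is trivial because a vector of [V] orthogonal to [V] is orthogonal to itself. *)
Lemma direct_sum_orth k V : has_dim k V -> V `<=` U -> direct_sum U V (orth_in V).
Proof.
move=> dV VU; have sV := has_dim_subspace dV; have [rho rB] := dV.
have [U0 UL] := sU.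
have Urho i : U (rho i) by apply: VU; exact: basis_in rB.
split => //; first exact: orth_subspace.
- apply/seteqP; split => [u Uu|u [v [w [Vv [Uw _] ->]]]]; last first.
    by rewrite -[v]scale1r; apply: UL => //; exact: VU.
  pose G := \matrix_(l < k, i < k) ip (rho l) (rho i).
  (* A left null vector of the Gram matrix gives an element of [V] orthogonal to every [rho i],
     hence to itself. *)
  have uG : G \in unitmx.
    rewrite -row_free_unit; apply: inj_row_free => b b0.
    apply/rowP => j; rewrite [RHS]mxE; apply: (rB.2 (fun j => b ord0 j)).
    have Us := subspace_sum (fun j => b ord0 j) sU Urho.
    apply: ip_eq0 => //; rewrite ip_suml//.
    rewrite big1// => i _; rewrite ipC ip_suml//.
    have /rowP/(_ i) := b0; rewrite !mxE => bi.
    transitivity (b ord0 i * \sum_(j0 < k) b ord0 j0 * G j0 i); last by rewrite bi mulr0.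
    by congr (_ * _); apply: eq_bigr => l _; rewrite !mxE.
  (* These coefficients solve the normal equations, which make [u - v] orthogonal to [V]. *)
  pose c := (\row_i ip u (rho i)) *m invmx G.
  pose v := \sum_i c ord0 i *: rho i.
  have Vv : V v by apply: subspace_sum => // i; exact: basis_in rB.
  have Uuv : U (u - v).
    by rewrite addrC -scaleN1r; apply: UL => //; exact: VU.
  exists v, (u - v); split => //; last by rewrite addrC subrK.
  split => // w; rewrite {1}rB.1 => -[a ->].
  rewrite ipC ip_suml//.
  rewrite big1// => i _; rewrite ipC.
  rewrite [u - v]addrC -scaleN1r (ipL (Urho i))//; last exact: VU.
  rewrite ip_suml//.
  have -> : \sum_i0 c ord0 i0 * ip (rho i0) (rho i) = (c *m G) ord0 i.
    by rewrite mxE; apply: eq_bigr => l _; rewrite [G _ _]mxE.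
  by rewrite mulmxKV// mxE mulN1r addNr mulr0.
- apply/seteqP; split => [u [Vu [Uu uV]]|u ->].
    by apply: ip_eq0 => //; exact: uV.
  by split; [case: sV|case: (orth_subspace VU)].
Qed.

End InnerProduct.

Lemma change_basis_is_basis n U (P : 'M[R]_n) (e : 'I_n -> E) :
  P \in unitmx -> is_basis U e -> is_basis U (change_basis P e).
Proof.
move=> uP [UE efree].
have sumE (a : 'I_n -> R) : \sum_i a i *: change_basis P e i =
    \sum_l (\sum_i P l i * a i) *: e l.
  rewrite /change_basis; under eq_bigr do rewrite scaler_sumr.
  rewrite exchange_big; apply: eq_bigr => l _ /=.
  by rewrite scaler_suml; apply: eq_bigr => i _; rewrite scalerA mulrC.
split.
  rewrite UE; apply/seteqP; split => _ [a ->].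
    exists (fun i => (invmx P *m \col_l a l) i ord0); rewrite sumE.
    apply: eq_bigr => l _; congr (_ *: _).
    have -> : \sum_i P l i * (invmx P *m \col_l a l) i ord0 =
       (P *m (invmx P *m \col_l a l)) l ord0 by rewrite [RHS]mxE.
    by rewrite mulKVmx// mxE.
  by rewrite sumE; eexists.
move=> a; rewrite sumE => /efree a0 i.
have Pa : P *m (\col_i a i) = 0.
  apply/colP => l; rewrite !mxE -[RHS](a0 l).
  by apply: eq_bigr => j _; rewrite mxE.
have : \col_i a i = 0 by rewrite -[LHS](mulKmx uP) Pa mulmx0.
by move/colP/(_ i); rewrite !mxE.
Qed.

End FiniteDimension.

(** * Dimension of polynomial spaces and injectivity of evaluation *)

(* Dropping the first exponent identifies the multinomials of degree k in n + 1
   variables with those of degree at most k in n variables. *)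
Lemma card_bmultinom n k : #|{: bmultinom n k.+1}| = 'C(k + n, k).
Proof.
pose tl (m : multinom n.+1) : multinom n :=
  Multinom (mktuple (fun i => m (lift ord0 i))).
pose s0 := [seq s2m (val t) | t <- enum (mpoly.basis n.+1 k)].
have s0deg m : (m \in s0) = (mdeg m == k) by rewrite basis_cover.
have mdeg_tl m : mdeg m = (m ord0 + mdeg (tl m))%N.
  rewrite !mdegE big_ord_recl; congr (_ + _)%N.
  by apply: eq_bigr => i _; rewrite mnmE.
have tl_inj : {in s0 &, injective tl}.
  move=> m1 m2; rewrite !s0deg => /eqP d1 /eqP d2 tlE.
  apply/mnmP => i; case: (unliftP ord0 i) => [j|] ->.
    by move/mnmP/(_ j): tlE; rewrite !mnmE.
  by move: d1; rewrite -d2 !mdeg_tl tlE => /addIn.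
rewrite -(size_basis n k) -/s0 -(size_map tl) cardE -(size_map val).
apply/perm_size/uniq_perm; first by rewrite (map_inj_uniq val_inj) enum_uniq.
  by rewrite map_inj_in_uniq// uniq_basis.
move=> m; apply/mapP/mapP => [[b _ ->]|[m']].
  (* The preimage under [tl]: the first exponent absorbs the missing degree. *)
  pose h := Multinom (mktuple (fun i : 'I_n.+1 =>
    if unlift ord0 i is Some j then (bmnm b) j else (k - mdeg (bmnm b))%N)).
  have tlh : tl h = bmnm b by apply/mnmP => i; rewrite !mnmE liftK.
  exists h; last by rewrite tlh.
  by rewrite s0deg mdeg_tl tlh mnmE unlift_none subnK// -ltnS bmdeg.
rewrite s0deg => /eqP m'k ->.
have lt : (mdeg (tl m') < k.+1)%N by rewrite ltnS -m'k mdeg_tl leq_addl.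
by exists (BMultinom lt); rewrite ?mem_enum.
Qed.

(** A nonzero polynomial has fewer roots than its size, whereas the first [size P] values of [f]
    would all be roots. *)
Lemma poly_injective_roots (R : idomainType) (P : {poly R}) (f : nat -> R) :
  injective f -> (forall k, root P (f k)) -> P = 0.
Proof.
move=> fI Pf; apply/eqP/negP => /negP P0.
have := max_poly_roots P0 (rs := [seq f k | k <- iota 0 (size P)]).
rewrite size_map size_iota ltnn => toomany; suff: false by [].
apply: toomany; first by apply/allP => _ /mapP[k _ ->].
by rewrite (map_inj_uniq fI) iota_uniq.
Qed.

(** Uniqueness of digits in base K: reduction modulo K isolates the lowest digit, and induction
    handles the quotient by K. *)
Lemma radix_inj (K n : nat) (a b : 'I_n -> nat) :
  (forall i, a i < K)%N -> (forall i, b i < K)%N ->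
  (\sum_i a i * K ^ i = \sum_i b i * K ^ i)%N -> a =1 b.
Proof.
elim: n a b => [|n IH] a b aK bK; first by move=> _ [].
have split_sum (c : 'I_n.+1 -> nat) :
    (\sum_i c i * K ^ i = (\sum_(i < n) c (lift ord0 i) * K ^ i) * K + c ord0)%N.
  rewrite big_ord_recl expn0 muln1 addnC; congr addn.
  rewrite big_distrl; apply: eq_bigr => i _ /=.
  by rewrite /bump/= add1n expnSr mulnA.
rewrite !split_sum => abE.
have ab0 : a ord0 = b ord0.
  by move/(congr1 (modn^~ K)): abE; rewrite !modnMDl !modn_small.
have K0 : (0 < K)%N by apply: leq_ltn_trans (aK ord0).
move: abE; rewrite ab0 => /addIn/eqP; rewrite eqn_pmul2r// => /eqP/IH abS.
move=> i; case: (unliftP ord0 i) => [j|] -> //.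
by apply: (abS _ _ j) => l.
Qed.

Section PolynomialFunctions.
Context (R : realType).

(* Kronecker substitution: on the curve [t |-> (t ^ (K ^ i))_i], distinct
   monomials of partial degrees < K restrict to distinct powers of [t]. *)
Lemma meval_eq0 d (p : mpoly d R) :
  (forall x : 'rV[R]_d, meval (x ord0) p = 0) -> p = 0.
Proof.
move=> p0; pose K := mmeasure mdeg p.
pose code (m : multinom d) := (\sum_i m i * K ^ i)%N.
have ltK m i : m \in msupp p -> (m i < K)%N.
  move=> /(mmeasure_mnm_lt mdeg); apply: leq_ltn_trans.
  by rewrite [leqRHS]mdegE (bigD1 i)//= leq_addr.
have code_inj : {in msupp p &, injective code}.
  move=> m1 m2 m1p m2p /radix_inj E; apply/mnmP/E => i; exact: ltK.
pose P : {poly R} := \sum_(m <- msupp p) mcoeff m p *: 'X^(code m).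
have P0 : P = 0.
  apply: (@poly_injective_roots _ _ (fun k => k%:R)).
    by move=> a b /eqP; rewrite eqr_nat => /eqP.
  move=> k; apply/rootP.
  rewrite -(p0 (\row_i k%:R ^+ (K ^ i))) mevalE horner_sum.
  apply: eq_bigr => m _; rewrite hornerZ hornerXn; congr (_ * _).
  rewrite -prodrXr; apply: eq_bigr => i _.
  by rewrite mxE -exprM mulnC.
apply/mpolyP => m; rewrite mcoeff0; apply/eqP; rewrite mcoeff_eq0.
apply/negP => mp; have /eqP := mp; rewrite eqb_id mcoeff_msupp => /negP; apply.
(* As [code] is injective on the support, only [m] contributes to the coefficient of degree [code m]
   in [P]. *)
have := congr1 (fun Q : {poly R} => Q`_(code m)) P0.
rewrite coef0 coef_sum (bigD1_seq m)//= ?msupp_uniq// coefZ coefXn eqxx mulr1.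
rewrite big_seq_cond big1 ?addr0 => [->//|m' /andP[m'p m'm]].
rewrite coefZ coefXn; case: eqP => [/code_inj E|_]; last by rewrite mulr0.
by rewrite E// eqxx in m'm.
Qed.

(** Along the line from x to an arbitrary y, [p] is a univariate polynomial with infinitely many
    roots near t = 0, so it also vanishes at t = 1, which is y. *)
Lemma meval_nbhs_eq0 d (X : set 'rV[R]_d) (x : 'rV[R]_d) (p : mpoly d R) :
  nbhs x X -> (forall y, X y -> meval (y ord0) p = 0) -> p = 0.
Proof.
move=> xX Xp; apply: meval_eq0 => y.
pose u := y - x.
have : (fun t : R => x + t *: u) @ 0 --> x + 0 *: u.
  by apply: cvgD; [exact: cvg_cst|apply: cvgZr_tmp; exact: cvg_id].
rewrite scale0r addr0 => /(_ _ xX) /nbhs_ballP[e /= e0 eX].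
pose P : {poly R} := \sum_(m <- msupp p)
  mcoeff m p *: \prod_i ((x ord0 i)%:P + (u ord0 i) *: 'X) ^+ m i.
have PE t : P.[t] = meval ((x + t *: u) ord0) p.
  rewrite horner_sum mevalE; apply: eq_bigr => m _; rewrite hornerZ; congr (_ * _).
  rewrite horner_prod; apply: eq_bigr => i _.
  by rewrite horner_exp hornerD hornerC hornerZ hornerX !mxE [t * _]mulrC.
have P0 : P = 0.
  (* Dividing by [k.+2] keeps every parameter strictly below the radius [e], even for k = 0. *)
  apply: (@poly_injective_roots _ _ (fun k => e / k.+2%:R)).
    move=> a b /(mulfI (lt0r_neq0 e0))/invr_inj/eqP.
    by rewrite eqr_nat => /eqP[].
  move=> k; apply/rootP; rewrite PE; apply: Xp; apply: eX.
  rewrite /ball/= sub0r normrN ger0_norm ?divr_ge0 ?ltW//.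
  by rewrite ltr_pdivrMr// ltr_pMr// ltr1n.
have := PE 1; rewrite P0 horner0 => ->.
by congr (meval (_ _) p); rewrite scale1r /u addrC subrK.
Qed.

Definition mpoly_on d (X : set 'rV[R]_d) (p : mpoly d R) : 'rV[R]_d -> R :=
  (fun x => meval (x ord0) p) \_ X.

Lemma mpoly_onE d (X : set 'rV[R]_d) (p : mpoly d R) x :
  X x -> mpoly_on X p x = meval (x ord0) p.
Proof. by move=> Xx; rewrite /mpoly_on patchE mem_set. Qed.

Lemma mpoly_on_linear d (X : set 'rV[R]_d) (a : R) (p r : mpoly d R) :
  mpoly_on X (a *: p + r) = a *: mpoly_on X p + mpoly_on X r.
Proof.
apply/funext => x; rewrite /mpoly_on !fctE !patchE.
by case: ifP => _; rewrite ?mevalD ?mevalZ// scaler0 addr0.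
Qed.

Lemma mpoly_on0 d (X : set 'rV[R]_d) : mpoly_on X 0 = 0.
Proof. by apply/funext => x; rewrite /mpoly_on patchE meval0 if_same. Qed.

Lemma mpoly_on_sum d (X : set 'rV[R]_d) (I : finType) (a : I -> R)
    (p : I -> mpoly d R) :
  mpoly_on X (\sum_i a i *: p i) = \sum_i a i *: mpoly_on X (p i).
Proof.
elim/big_ind2 : _ => [|f1 p1 f2 p2 <- <-|i _]; first exact: mpoly_on0.
  by rewrite -[p1]scale1r mpoly_on_linear !scale1r.
by rewrite -[_ *: p i]addr0 mpoly_on_linear mpoly_on0 addr0.
Qed.

(** An interior point of X makes restriction to X injective on polynomials, so the monomials of
    degree at most k stay independent. *)
Lemma has_dim_poly_space d (X : set 'rV[R]_d) (x : 'rV[R]_d) k :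
  nbhs x X -> has_dim 'C(k + d, k) (poly_space k X).
Proof.
move=> xX; rewrite -card_bmultinom.
pose N := #|{: bmultinom d k.+1}|.
pose m (i : 'I_N) : multinom d := bmnm (enum_val i).
have sumE (a : 'I_N -> R) : \sum_i a i *: mpoly_on X (mpolyX R (m i)) =
    mpoly_on X (\sum_i a i *: mpolyX R (m i)) by rewrite mpoly_on_sum.
exists (fun i => mpoly_on X (mpolyX R (m i))); split.
  apply/seteqP; split => [_ [p pk ->]|_ [a ->]].
    exists (fun i => mcoeff (m i) p); rewrite sumE; congr (mpoly_on X _).
    rewrite {1}(mpolywE pk) (reindex (@enum_val {: bmultinom d k.+1} xpredT))//=.
    by apply: onW_bij; exact: enum_val_bij.
  rewrite sumE; eexists; last by reflexivity.
  apply: leq_trans (mmeasure_sum _ _ _ _) _; apply/bigmax_leqP => i _.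
  apply: leq_trans (mmeasureZ_le _ _ _) _; rewrite mmeasureX.
  exact: bmdeg.
move=> a; rewrite sumE => a0 i.
have p0 : \sum_i a i *: mpolyX R (m i) = 0.
  apply: meval_nbhs_eq0 xX _ => y Xy.
  by rewrite -(mpoly_onE _ Xy) a0.
have := congr1 (mcoeff (m i)) p0; rewrite mcoeff0 raddf_sum /= (bigD1 i)//=.
rewrite mcoeffZ mcoeffX eqxx mulr1 big1 ?addr0// => j ji.
rewrite mcoeffZ mcoeffX; case: eqP => [/val_inj/enum_val_inj E|_].
  by rewrite E eqxx in ji.
by rewrite mulr0.
Qed.

End PolynomialFunctions.

(** * Regularity of polynomial functions and integrability against a density *)

Section PolynomialRegularity.
Context (R : realType) (d : nat).
Implicit Types (p r : mpoly d R) (X : set 'rV[R]_d).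

Lemma measurable_meval p :
  measurable_fun [set: 'rV[R]_d] (fun x : 'rV[R]_d => meval (x ord0) p).
Proof.
under eq_fun do rewrite mevalE.
apply: measurable_sum => m; apply: measurable_funM; first exact: measurable_cst.
apply: measurable_prod => i _; apply: measurable_funX; exact: measurable_coord.
Qed.

Lemma continuous_meval p : continuous (fun x : 'rV[R]_d => meval (x ord0) p).
Proof.
elim/mpolyind : p => [|c m p _ _ IH] x.
  by rewrite (_ : (fun _ => _) = cst 0); [exact: cst_continuous|
    apply/funext => y; rewrite meval0].
have cprod (s : seq 'I_d) :
    continuous (fun y : 'rV[R]_d => \prod_(i <- s) y ord0 i ^+ m i).
  elim: s => [|i s IHs] y.
    rewrite (_ : (fun _ => _) = cst 1); first exact: cst_continuous.
    by apply/funext => z; rewrite big_nil.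
  rewrite (_ : (fun _ => _) = (fun z : 'rV[R]_d => z ord0 i ^+ m i) \*
      (fun z => \prod_(l <- s) z ord0 l ^+ m l)); last first.
    by apply/funext => z; rewrite big_cons.
  apply: continuousM; last exact: IHs.
  apply: (@continuous_comp _ _ _ (fun z : 'rV[R]_d => z ord0 i) (fun t : R => t ^+ m i)).
    exact: coord_continuous.
  exact: exprn_continuous.
rewrite (_ : (fun _ => _) = (fun y : 'rV[R]_d => c * \prod_i y ord0 i ^+ m i) \+
    (fun y => meval (y ord0) p)); last first.
  by apply/funext => y; rewrite mevalD mevalZ mevalX.
apply: continuousD; last exact: IH.
by apply: (continuousM (s := cst c)); [exact: cst_continuous|exact: cprod].
Qed.

Lemma meval_bounded p X (B : R) :
  (forall x, X x -> forall i, `|x ord0 i| <= B) ->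
  exists M, forall x, X x -> `|meval (x ord0) p| <= M.
Proof.
move=> XB; exists (\sum_(m <- msupp p) `|mcoeff m p| * \prod_i B ^+ m i).
move=> x Xx; rewrite mevalE; apply: le_trans (ler_norm_sum _ _ _) _.
apply: ler_sum => m _; rewrite normrM ler_wpM2l// normr_prod.
apply: ler_prod => i _; rewrite normr_ge0/= normrX.
by apply: lerXn2r; rewrite ?nnegrE//; [exact: le_trans (XB _ Xx i)|exact: XB].
Qed.

Context (mu : {measure set 'rV[R]_d -> \bar R}).

(** On X the product f g is a polynomial, bounded because X is, so it preserves the integrability of
    w. Separate domains Y and Z allow a polynomial on the simplex to be paired with one on a
    face. *)
Lemma integrable_poly_density X (B : R) w f g k l Y Z :
  measurable X -> (forall x, X x -> forall i, `|x ord0 i| <= B) ->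
  mu.-integrable X (EFin \o w) ->
  X `<=` Y -> X `<=` Z -> poly_space k Y f -> poly_space l Z g ->
  mu.-integrable X (EFin \o (fun x => f x * g x * w x)).
Proof.
move=> mX XB wi XY XZ [p _ ->] [r _ ->].
apply: (eq_integrable mX ((EFin \o (fun x => meval (x ord0) (p * r))) \* (EFin \o w))%E).
  by move=> x /set_mem Xx /=; rewrite mevalM !patchE !mem_set//; [exact: XZ|exact: XY].
apply: integrableMr => //.
  by apply: measurable_funTS; exact: measurable_meval.
have [M XM] := meval_bounded (p * r) XB.
exists M; split; first exact: num_real.
move=> N MN x Xx /=; apply: le_trans (ltW MN); exact: XM.
Qed.

Lemma inner_linear X w f1 f2 g (a : R) :
  measurable X ->
  mu.-integrable X (EFin \o (fun x => f1 x * g x * w x)) ->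
  mu.-integrable X (EFin \o (fun x => f2 x * g x * w x)) ->
  inner mu X w (a *: f1 + f2) g = a * inner mu X w f1 g + inner mu X w f2 g.
Proof.
move=> mX i1 i2; rewrite /inner -RintegralZl// -RintegralD//; last first.
  rewrite (_ : _ \o _ = fun x => (a%:E * (f1 x * g x * w x)%:E)%E).
    exact: integrableZl.
  by apply/funext => x; rewrite /= EFinM.
by apply: eq_Rintegral => x _; rewrite !fctE /GRing.scale/= !mulrDl !mulrA.
Qed.

Lemma innerC X w f g : inner mu X w f g = inner mu X w g f.
Proof. by apply: eq_Rintegral => x _; rewrite [f x * _]mulrC. Qed.

End PolynomialRegularity.

(** By continuity a nonzero value persists on a ball. For the sup norm this ball is a box of measure
    (2e)^d > 0, which cannot lie in a null set. *)
Lemma ae_eq0_open (R : realType) d (p : mpoly d R) (U : set 'rV[R]_d) :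
  open U -> {ae lebesgue_rV d, forall x, U x -> meval (x ord0) p = 0} ->
  forall x, U x -> meval (x ord0) p = 0.
Proof.
move=> oU [N [mN N0 pN]] x Ux; apply: contrapT => /eqP px0.
have /nbhs_ballP[e /= e0 eN] : nbhs x (U `&` [set y | meval (y ord0) p != 0]).
  apply: filterI; first exact: open_nbhs_nbhs.
  have /cvgrPdist_lt := @continuous_meval R d p x.
  have : 0 < `|meval (x ord0) p| by rewrite normr_gt0.
  move=> h0 /(_ _ h0); apply: filterS => y; apply: contraTneq => ->.
  by rewrite subr0 ltxx.
pose A (i : 'I_d) : set R := ball (x ord0 i) e.
have mA i : measurable (A i) by exact: measurable_ball.
have boxN : [set y : 'rV[R]_d | forall i, A i (y ord0 i)] `<=` N.
  move=> y yA; apply: pN => /= pU.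
  have [Uy /eqP] : (U `&` [set y | meval (y ord0) p != 0]) y.
    by apply: eN; split => // i j; rewrite ord1; exact: yA.
  by apply; exact: pU.
have : (lebesgue_rV d [set y : 'rV[R]_d | forall i, A i (y ord0 i)] <= 0)%E.
  rewrite -N0; apply: le_measure => //; rewrite inE//.
  rewrite (_ : [set y | _] = \bigcap_(i in [set: 'I_d])
    (fun x : 'rV[R]_d => x ord0 i) @^-1` A i); last first.
    by apply/seteqP; split => z /= h i => [_|]; exact: h.
  apply: fin_bigcap_measurable => // i _.
  by rewrite -[X in measurable X]setTI; exact: measurable_coord.
rewrite leNgt lebesgue_rV_box// => /negP; apply.
rewrite (_ : (\prod_i _)%E = (\prod_(i < d) (e *+ 2))%:E).
  by rewrite lte_fin prodr_gt0// => i _; rewrite mulrn_wgt0.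
elim/big_ind2 : _ => [//|? ? ? ? -> ->|i _]; first by rewrite EFinM.
by rewrite lebesgue_measure_ball// ltW.
Qed.

(** * Geometry of the simplex: bounds, barycentric coordinates, interior, faces *)

Lemma simplex_coord_bounded (R : realType) m n (w : 'I_m.+1 -> 'rV[R]_n) :
  exists B, forall x, simplex w x -> forall k, `|x ord0 k| <= B.
Proof.
exists (\sum_i \sum_k `|w i ord0 k|) => _ [a [a0 a1 ->]] k.
rewrite summxE; apply: le_trans (ler_norm_sum _ _ _) _; apply: ler_sum => i _.
rewrite mxE normrM (ger0_norm (a0 i)) (bigD1 k)//= -[leLHS]addr0.
apply: lerD; last by rewrite sumr_ge0.
by rewrite ler_piMl// -a1 (bigD1 i)//= lerDl sumr_ge0.
Qed.

Section SimplexGeometry.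
Context (R : realType) (d : nat) (v : 'I_d.+1 -> 'rV[R]_d).
Hypothesis hv : affinely_independent v.

(** Two coefficient families of sum 1 for the same point differ by an affine relation between the
    vertices, which is trivial. *)
Lemma bary_unique (a : 'I_d.+1 -> R) : \sum_i a i = 1 ->
  forall j, bary v (\sum_i a i *: v i) j = a j.
Proof.
move=> a1 j; set x := \sum_i _; have [b1 bx] := baryP x hv.
apply/eqP; rewrite -subr_eq0; apply/eqP.
apply: (hv (a := fun i => bary v x i - a i)).
  by rewrite sumrB b1 a1 subrr.
by under eq_bigr do rewrite scalerBl; rewrite sumrB bx subrr.
Qed.

Lemma simplex_bary : simplex v = [set x | forall j, 0 <= bary v x j].
Proof.
apply/seteqP; split => [_ [a [a0 a1 ->]] j|x x0]; first by rewrite bary_unique.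
by have [b1 bx] := baryP x hv; exists (bary v x); split.
Qed.

(** Column j of the inverse vertex matrix read as an affine polynomial, so that [bary] inherits
    measurability and continuity from polynomials. *)
Definition bary_poly (j : 'I_d.+1) : mpoly d R :=
  mpolyC d (invmx (vertex_mx v) (lshift d (ord0 : 'I_1)) j) +
  \sum_k invmx (vertex_mx v) (rshift 1 k) j *: mpolyX R (mnm1 k).

Lemma bary_polyE j x : bary v x j = meval (x ord0) (bary_poly j).
Proof.
rewrite /bary mxE (@big_split_ord _ _ _ 1 d)/= big_ord1.
rewrite (row_mxEl (1%:M : 'rV[R]_1)) [_%:M _ _]mxE mul1r.
rewrite mevalD mevalC raddf_sum /=; congr (_ + _); apply: eq_bigr => k _.
by rewrite (row_mxEr (1%:M : 'rV[R]_1)) mevalZ mevalXU mulrC.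
Qed.

Lemma measurable_bary j : measurable_fun [set: 'rV[R]_d] (bary v ^~ j).
Proof. by under eq_fun do rewrite bary_polyE; exact: measurable_meval. Qed.

Lemma continuous_bary j : continuous (bary v ^~ j).
Proof.
rewrite (_ : bary v ^~ j = fun x => meval (x ord0) (bary_poly j)).
  exact: continuous_meval.
by apply/funext => x; rewrite bary_polyE.
Qed.

Lemma measurable_simplex : measurable (simplex v).
Proof.
rewrite simplex_bary (_ : [set x | _] =
    \bigcap_(j in [set: 'I_d.+1]) (bary v ^~ j) @^-1` `[0, +oo[%classic).
  apply: fin_bigcap_measurable => // j _.
  by rewrite -[X in measurable X]setTI; exact: measurable_bary.
by apply/seteqP; split => z /= h j => [_|]; have := h j; rewrite /= in_itv/= andbT //; apply.
Qed.

Lemma simplex_interior : exists x : 'rV[R]_d, nbhs x (simplex v).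
Proof.
(* The barycentre: its coordinates 1/(d+1) are positive, and finitely many strict inequalities
   between continuous functions persist nearby. *)
pose a (_ : 'I_d.+1) : R := d.+1%:R^-1.
have a1 : \sum_i a i = 1 by rewrite /a sumr_const card_ord -[LHS]mulr_natl divff ?pnatr_eq0.
exists (\sum_i a i *: v i); set x := \sum_i _.
rewrite simplex_bary.
suff near0 j : \forall y \near x, 0 <= bary v y j by exact: filter_forall near0.
have x0 : 0 < bary v x j by rewrite bary_unique// invr_gt0 ltr0n.
have := @continuous_bary j x; move/cvgr_gt => /(_ _ x0).
by apply: filterS => y /ltW.
Qed.

End SimplexGeometry.

(** This form yields the measurability of a face and its inclusion in the simplex. Writing the
    dimension as [d.+1] lets the [d.-1.+1] of [face_vertices] reduce, so that its indices become
    [lift j k]. *)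
Lemma face_bary (R : realType) d (v : 'I_d.+2 -> 'rV[R]_d.+1) j :
  affinely_independent v ->
  face v j = simplex v `&` [set x | bary v x j = 0].
Proof.
move=> hv; have vE k : face_vertices v j k = v (lift j k).
  by congr v; apply: val_inj; rewrite /= inordK// (ltn_ord (lift j k)).
apply/seteqP; split => [_ [a [a0 a1 ->]]|x [[a [a0 a1 ->]]]].
  pose b i := if unlift j i is Some k then a k else 0.
  have bj : b j = 0 by rewrite /b unlift_none.
  have bl k : b (lift j k) = a k by rewrite /b liftK.
  have b1 : \sum_i b i = 1.
    by rewrite (bigD1_ord j)//= bj add0r -a1; apply: eq_bigr => k _; rewrite bl.
  have bx : \sum_k a k *: face_vertices v j k = \sum_i b i *: v i.
    rewrite (bigD1_ord j)//= bj scale0r add0r.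
    by apply: eq_bigr => k _; rewrite bl vE.
  rewrite bx; split; last by rewrite /= bary_unique.
  by exists b; split => // i; rewrite /b; case: unlift.
rewrite /= bary_unique// => aj0; exists (fun k => a (lift j k)); split => //.
  by rewrite -a1 [RHS](bigD1_ord j)//= aj0 add0r.
rewrite (bigD1_ord j)//= aj0 scale0r add0r.
by apply: eq_bigr => k _; rewrite vE.
Qed.


Lemma face_sub_simplex (R : realType) d (v : 'I_d.+1 -> 'rV[R]_d) j :
  (0 < d)%N -> affinely_independent v -> face v j `<=` simplex v.
Proof.
by case: d v j => // d v j _ hv; rewrite (face_bary j hv); exact: subIsetl.
Qed.

Lemma measurable_face (R : realType) d (v : 'I_d.+1 -> 'rV[R]_d) j :
  (0 < d)%N -> affinely_independent v -> measurable (face v j).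
Proof.
case: d v j => // d v j _ hv; rewrite (face_bary j hv).
apply: measurableI; first exact: measurable_simplex.
rewrite (_ : [set x | _] = (bary v ^~ j) @^-1` [set 0])//.
by rewrite -[X in measurable X]setTI; exact: measurable_bary.
Qed.

(** * The space S_2: definiteness of the inner product, dimension, decomposition *)

Lemma S2_sub_poly_space (R : realType) d (v : 'I_d.+1 -> 'rV[R]_d) Omega :
  S2 v Omega `<=` poly_space 2 (simplex v).
Proof. by move=> p []. Qed.

Lemma poly_spaceS (R : realType) d (X : set 'rV[R]_d) k l :
  (k <= l)%N -> poly_space k X `<=` poly_space l X.
Proof. by move=> kl _ [p pk ->]; exists p => //; apply: leq_trans pk _. Qed.

(** The function f^2 Omega is nonnegative a.e. with zero integral, so it vanishes a.e.; positivity
    of Omega in the interior then forces f to vanish a.e. there. *)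
Lemma inner_Omega_eq0 (R : realType) d (v : 'I_d.+1 -> 'rV[R]_d)
    (Omega : 'rV[R]_d -> R) k f :
  affinely_independent v ->
  probability_density (lebesgue_rV d) (simplex v) Omega ->
  {ae (lebesgue_rV d), forall x : 'rV[R]_d, (simplex v)° x -> 0 < Omega x} ->
  poly_space k (simplex v) f -> inner_Omega v Omega f f = 0 -> f = 0.
Proof.
move=> hv [iO O0 _] Opos fk ff0.
have mS := measurable_simplex hv.
have [B SB] := simplex_coord_bounded v.
have iF := integrable_poly_density mS SB iO (@subset_refl _ _) (@subset_refl _ _) fk fk.
set F := fun x => _ in iF.
have mF : measurable_fun (simplex v) (EFin \o F) by case/integrableP: iF.
have absF : {ae lebesgue_rV d, forall x, simplex v x -> (`|(EFin \o F) x| = (EFin \o F) x)%E}.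
  apply: filterS O0 => x Ox Sx; rewrite /= ger0_norm// /F mulr_ge0 ?Ox//.
  by rewrite -expr2 sqr_ge0.
have /ae_eq_integral_abs : (\int[lebesgue_rV d]_(x in simplex v) `|(EFin \o F) x| = 0)%E.
  rewrite (ae_eq_integral (EFin \o F))//; last exact: measurableT_comp.
  (* [fine] sends infinite values to 0, so [ff0] determines the extended integral only once that
     integral is known to be finite. *)
  rewrite -[LHS]fineK; last exact: integrable_fin_num.
  by congr EFin.
move=> /(_ mS mF) F0.
have [x xS] := simplex_interior hv.
move: fk => [p _ fE].
suff p0 : p = 0 by rewrite fE p0; exact: mpoly_on0.
apply: (@meval_nbhs_eq0 _ _ (simplex v)° x); first exact: nbhs_interior.
apply: ae_eq0_open; first exact: open_interior.
apply: filterS2 Opos F0 => y Oy Fy Iy.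
have Sy : simplex v y by exact: interior_subset.
have := Fy Sy; rewrite /= /F => -[] /eqP; rewrite mulf_eq0 (gt_eqF (Oy Iy)) orbF.
by rewrite mulf_eq0 orbb fE patchE mem_set// => /eqP.
Qed.

Lemma dim_S2 d : (2 <= d)%N ->
  ('C(2 + d, 2) - 'C(1 + d, 1) = dtilde d + d.+1)%N.
Proof.
move=> d2; have [n ->] : exists n, d = n.+2 by exists (d - 2)%N; rewrite -addn2 subnK.
(* Half of (n+4)(n+3) = 4(n+3) + n(n+3); removing dim P_1 = n+3 leaves (n+3) + n(n+3)/2, where n = d
   - 2. *)
have -> : ('C(2 + n.+2, 2) = n.+3.*2 + (n * n.+3)./2)%N.
  rewrite bin2 (_ : (_ * _ = n.+3.*2.*2 + n * n.+3)%N).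
    by rewrite halfD odd_double doubleK.
  by rewrite -!muln2 -mulnA (mulnC n.+3 (2 * 2)%N) -mulnDl.
by rewrite bin1 /dtilde subn2 add1n addn1 /= -addnn -addnA addKn addnC.
Qed.

Theorem theorem2 (R : realType) (d : nat) (hd : (2 <= d)%N)
  (v : 'I_d.+1 -> 'rV[R]_d) (hv : affinely_independent v)
  (Omega : 'rV[R]_d -> R)
  (hOmega : probability_density (lebesgue_rV d) (simplex v) Omega)
  (hOmega_pos : {ae (lebesgue_rV d),
     forall x : 'rV[R]_d, (simplex v)° x -> 0 < Omega x})
  (omega : 'I_d.+1 -> 'rV[R]_d -> R)
  (homega : forall j,
     probability_density (face_measure v j) (face v j) (omega j))
  (homega_pos : forall j, {ae (face_measure v j),
     forall x : 'rV[R]_d, face v j x -> 0 < omega j x})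
  (htrace : forall j, conditional_trace v Omega j (omega j))
  (q : 'I_d.+1 -> 'rV[R]_d -> R)
  (hq : forall j, poly_space 2 (face v j) (q j))
  (hq_orth : forall j phi, poly_space 1 (face v j) phi ->
     inner_face v omega j (q j) phi = 0)
  (hL : forall c : 'I_d.+1 -> R,
     (forall p, S2 v Omega p ->
        \sum_j c j * face_functional v omega q j p = 0) ->
     forall j, c j = 0) :
  exists V W : set ('rV[R]_d -> R),
    [/\ direct_sum (S2 v Omega) V W /\ has_dim (dtilde d) V,
        has_dim d.+1 W /\
        (forall f g, W f -> V g -> inner_Omega v Omega f g = 0),
        (forall psi : 'I_d.+1 -> 'rV[R]_d -> R,
           is_basis W psi -> M_mx v omega q psi \in unitmx),
        (forall psi : 'I_d.+1 -> 'rV[R]_d -> R, is_basis W psi ->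
           exists P : 'M[R]_d.+1,
             [/\ P \in unitmx, is_basis W (change_basis P psi) &
                 M_mx v omega q (change_basis P psi) = 1%:M]) &
        (forall (psi : 'I_d.+1 -> 'rV[R]_d -> R)
                (rho : 'I_(dtilde d) -> 'rV[R]_d -> R),
           is_basis W psi -> M_mx v omega q psi = 1%:M ->
           is_basis V rho ->
           (forall k l, inner_Omega v Omega (rho k) (rho l) = (k == l)%:R) ->
           [/\ G_mx v Omega rho = 1%:M,
               C_mx v Omega rho psi = 0,
               T_mx v Omega omega q rho psi = M_mx v omega q psi &
               T_mx v Omega omega q rho psi = 1%:M])].
Proof.
have mS := measurable_simplex hv.
have [iO _ _] := hOmega.
have [B SB] := simplex_coord_bounded v.
have [x xS] := simplex_interior hv.
pose ip := inner_Omega v Omega.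
have dP2 : has_dim 'C(2 + d, 2) (poly_space 2 (simplex v)) by exact: has_dim_poly_space xS.
have dP1 : has_dim 'C(1 + d, 1) (poly_space 1 (simplex v)) by exact: has_dim_poly_space xS.
have P12 : poly_space 1 (simplex v) `<=` poly_space 2 (simplex v) by exact: poly_spaceS.
have ipC f g : ip f g = ip g f by exact: innerC.
have ipL w : poly_space 2 (simplex v) w -> linear_on (poly_space 2 (simplex v)) (ip^~ w).
  move=> Pw a f g Pf Pg; apply: inner_linear => //.
    exact: integrable_poly_density mS SB iO (@subset_refl _ _) (@subset_refl _ _) Pf Pw.
  exact: integrable_poly_density mS SB iO (@subset_refl _ _) (@subset_refl _ _) Pg Pw.
have ip0 u : poly_space 2 (simplex v) u -> ip u u = 0 -> u = 0 by exact: inner_Omega_eq0.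
(* [S2] is convertible to [orth_in] applied to P_1 inside P_2. *)
have dS : has_dim (dtilde d + d.+1) (S2 v Omega).
  rewrite -dim_S2//.
  exact: (has_dim_orth (has_dim_subspace dP2) ipL ipC ip0 dP2 dP1 P12).
have SP := @S2_sub_poly_space R d v Omega.
have sS := has_dim_subspace dS.
have ipLS w : S2 v Omega w -> linear_on (S2 v Omega) (ip^~ w).
  by move=> /SP Pw a f g /SP Pf /SP Pg; exact: ipL.
have ip0S u : S2 v Omega u -> ip u u = 0 -> u = 0 by move=> /SP; exact: ip0.
have LL j : linear_on (S2 v Omega) (face_functional v omega q j).
  move=> a f g /SP Pf /SP Pg.
  have mF : measurable (face v j) by apply: measurable_face => //; exact: ltnW.
  have FS : face v j `<=` simplex v by apply: face_sub_simplex => //; exact: ltnW.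
  have [iw _ _] := homega j.
  have FB y (Fy : face v j y) := SB y (FS y Fy).
  apply: inner_linear => //.
    exact: integrable_poly_density mF FB iw FS (@subset_refl _ _) Pf (hq j).
  exact: integrable_poly_density mF FB iw FS (@subset_refl _ _) Pg (hq j).
pose V := [set u | S2 v Omega u /\ forall j, face_functional v omega q j u = 0].
have VS : V `<=` S2 v Omega by move=> u [].
have dV : has_dim (dtilde d) V.
  by have := has_dim_kernel dS LL hL; rewrite addnK.
pose W := orth_in (S2 v Omega) ip V.
have dW : has_dim d.+1 W.
  by have := has_dim_orth sS ipLS ipC ip0S dS dV VS; rewrite addKn.
have dsum : direct_sum (S2 v Omega) V W by exact: direct_sum_orth dV VS.
have Wunit psi : is_basis W psi -> M_mx v omega q psi \in unitmx.
  (* Null vectors of M are columns; transposing turns them into rows. *)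
  move=> psiB; rewrite -unitmx_tr -row_free_unit; apply: inj_row_free => b b0.
  have Spsi i : S2 v Omega (psi i) by have [] := basis_in i psiB.
  have Ww : W (\sum_i b ord0 i *: psi i).
    apply: subspace_sum => [|i]; [exact: has_dim_subspace dW|exact: basis_in].
  (* The equations M b = 0 say that every L_j vanishes on this vector of W. *)
  have Vw : V (\sum_i b ord0 i *: psi i).
    split=> [|j]; first by case: Ww.
    rewrite (linear_on_sum _ sS (LL j))//.
    have /rowP/(_ j) := b0; rewrite !mxE => bj; rewrite -[RHS]bj.
    by apply: eq_bigr => i _; rewrite !mxE.
  apply/rowP => i; rewrite [RHS]mxE; apply: (psiB.2 (fun i => b ord0 i)).
  by have [_ _ _ /seteqP[+ _]] := dsum; apply.
exists V, W; split => //.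
- by split => // f g [_ Wf] /Wf.
- move=> psi psiB; have uM := Wunit _ psiB; exists (invmx (M_mx v omega q psi)).
  have Spsi i : S2 v Omega (psi i) by have [] := basis_in i psiB.
  split; first by rewrite unitmx_inv.
    by apply: change_basis_is_basis => //; rewrite unitmx_inv.
  (* By linearity of L_j, changing the basis by P replaces M with M P, here with P the inverse of
     M. *)
  rewrite -[RHS](mulmxV uM); apply/matrixP => j i; rewrite [LHS]mxE.
  rewrite /change_basis (linear_on_sum _ sS (LL j))// [RHS]mxE.
  by apply: eq_bigr => l _; rewrite [M_mx _ _ _ _ _ _]mxE mulrC.
- move=> psi rho psiB M1 rhoB rho_on.
  have C0 : C_mx v Omega rho psi = 0.
    apply/matrixP => k i; rewrite !mxE.
    by have [_] := basis_in i psiB; apply; exact: basis_in rhoB.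
  (* With C = 0, which comes from the orthogonality of W and V, the Schur correction vanishes. *)
  have TM : T_mx v Omega omega q rho psi = M_mx v omega q psi.
    by rewrite /T_mx C0 mulmx0 subr0.
  split => //; last by rewrite TM.
  by apply/matrixP => k l; rewrite !mxE rho_on eq_sym.
Qed.
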